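(* For an integral domain $A$ the following are equivalent. (i) $A$ is a Bezout domain. (ii) $A$ is a Prüfer domain and has a nonzero finitely generated PS module. (iii) All torsion-free $A$-modules are PS modules.
   Context: All rings are commutative and unitary. Let $A$ be an integral domain. A torsion-free $A$-module $M$ is a PS module (pre-Schreier module) if every equality $ax=by$ with $a,b\in A-\{0\}$ and $x,y\in M-\{0\}$ has a refinement, i.e. there exist $c,d,e\in A$ and $z\in M$ with $a=ce$, $b=cd$, $x=dz$, $y=ez$. A Bezout domain is a domain whose finitely generated ideals are principal; a Prüfer domain is a domain whose nonzero finitely generated ideals are invertible. *)

(* Defs.v *)
From HB Require Import structures.
From mathcomp Require Import all_boot all_order all_algebra.
From mathcomp Require Import boolp classical_sets.

Set Implicit Arguments.
Unset Strict Implicit.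
Unset Printing Implicit Defensive.

Import GRing.Theory.
Local Open Scope ring_scope.
Local Open Scope classical_set_scope.

Section Ideals.
Variable A : idomainType.

(* [idealr] of ssralg is a boolean predicate and excludes the unit ideal,
   hence this Prop-valued version in which 0 and A are both ideals. *)
Definition is_ideal (I : set A) : Prop :=
  [/\ I 0, forall x y, I x -> I y -> I (x + y) &
      forall a x, I x -> I (a * x)].

Definition ideal_span (n : nat) (g : 'I_n -> A) : set A :=
  [set x | exists c : 'I_n -> A, x = \sum_(i < n) c i * g i].

Definition fg_ideal (I : set A) : Prop :=
  exists (n : nat) (g : 'I_n -> A), I = ideal_span g.

Definition principal_ideal (I : set A) : Prop :=
  exists d : A, I = [set x | exists c : A, x = c * d].

Definition bezout_domain : Prop :=
  forall I : set A, is_ideal I -> fg_ideal I -> principal_ideal I.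

(* {fraction A} has no canonical A-module structure: A acts through the
   embedding [tofrac]. *)
Definition fractional_ideal (J : set {fraction A}) : Prop :=
  [/\ J 0, forall x y, J x -> J y -> J (x + y),
      forall (a : A) x, J x -> J (tofrac a * x) &
      exists2 d : A, d != 0 & forall x, J x -> exists a : A, tofrac d * x = tofrac a].

Definition frac_ideal_mul (I J : set {fraction A}) : set {fraction A} :=
  [set z | exists (n : nat) (x y : 'I_n -> {fraction A}),
     [/\ forall i, I (x i), forall i, J (y i) & z = \sum_(i < n) x i * y i]].

Definition invertible_ideal (I : set A) : Prop :=
  exists2 J : set {fraction A}, fractional_ideal J &
    frac_ideal_mul [set tofrac a | a in I] J = range (@tofrac A).

Definition prufer_domain : Prop :=
  forall I : set A, is_ideal I -> fg_ideal I -> I <> [set 0] ->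
    invertible_ideal I.

End Ideals.

Section Modules.
Variables (A : idomainType) (M : lmodType A).

Definition torsion_free : Prop :=
  forall (a : A) (x : M), a *: x = 0 -> a = 0 \/ x = 0.

Definition ps_module : Prop :=
  torsion_free /\
  forall (a b : A) (x y : M), a != 0 -> b != 0 -> x != 0 -> y != 0 ->
    a *: x = b *: y ->
    exists (c d e : A) (z : M),
      [/\ a = c * e, b = c * d, x = d *: z & y = e *: z].

Definition fg_module : Prop :=
  exists (n : nat) (g : 'I_n -> M), forall x : M,
    exists c : 'I_n -> A, x = \sum_(i < n) c i *: g i.

Definition nonzero_module : Prop := exists x : M, x != 0.

End Modules.

(* Main.v *)
(** The two nontrivial implications rest on one remark: if any two elements of
    a finitely generated ideal [I] have a common divisor lying in [I], then [I]
    is principal.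

    If every torsion-free module is PS, so is each ideal [I]; refining
    [y *: x = x *: y] inside [I] produces such a common divisor.

    Let [A] be Prufer and [M] a nonzero finitely generated PS module.  There is
    a nonzero linear form [f : M -> A], and its image, being invertible, lifts
    back to [M] by a section of [f].  Refining [t *: s r = r *: s t] for the
    section [s] shows that the image of [f] is principal, so [f] may be rescaled
    to be surjective, and [A] inherits the PS property from [M].  Finally, if
    [(a, b)] is invertible, then [1 = a q + b q'] with [q, q'] in [(a, b)^-1];
    refinements in [A] give a common divisor [c] of [a] and [b] that is a
    denominator of both [q] and [q'], whence [c] lies in [(a, b)]. *)

Require Import Defs.
From HB Require Import structures.
From mathcomp Require Import all_boot all_order all_algebra.
From mathcomp Require Import boolp classical_sets.
From mathcomp Require Import ring.

Set Implicit Arguments.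
Unset Strict Implicit.
Unset Printing Implicit Defensive.

Import GRing.Theory.
Local Open Scope ring_scope.
Local Open Scope classical_set_scope.

(** * Ideals: common divisors, Bezout relations and invertibility *)

Section IdealFacts.
Variable A : idomainType.
Implicit Types (I : set A) (a b c x y : A).

Lemma is_ideal_span n (g : 'I_n -> A) : is_ideal (ideal_span g).
Proof.
split; first by exists (fun=> 0); rewrite big1 // => i _; rewrite mul0r.
- move=> x y [c ->] [d ->]; exists (fun i => c i + d i).
  by rewrite -big_split; apply: eq_bigr => i _; rewrite mulrDl.
- move=> a x [c ->]; exists (fun i => a * c i).
  by rewrite mulr_sumr; apply: eq_bigr => i _; rewrite mulrA.
Qed.

Lemma mem_ideal_span n (g : 'I_n -> A) i : ideal_span g (g i).
Proof.
exists (fun j => (j == i)%:R); rewrite (bigD1 i) //= eqxx mul1r big1 ?addr0 //.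
by move=> j /negbTE ->; rewrite mul0r.
Qed.

Definition has_common_divisors I : Prop :=
  forall x y, I x -> I y -> exists c u v, [/\ I c, x = u * c & y = v * c].

(** The empty family has divisor 0. Each further member replaces [c] by a common divisor of [c] and
    that member, which stays in [I]. *)
Lemma common_divisor_family I n (g : 'I_n -> A) :
  is_ideal I -> has_common_divisors I -> (forall i, I (g i)) ->
  exists2 c, I c & forall i, exists u, g i = u * c.
Proof.
move=> [I0 ID IM] cdI; elim: n g => [|n IHn] g Ig.
  by exists 0 => // -[].
have [c Ic dvc] := IHn (fun i => g (lift ord0 i)) (fun i => Ig _).
have [d [u [v [Id cE gE]]]] := cdI _ _ Ic (Ig ord0).
exists d => // i; case: (unliftP ord0 i) => [j|] ->; last by exists v.
by have [w ->] := dvc j; exists (w * u); rewrite cE mulrA.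
Qed.

Lemma common_divisors_principal I :
  is_ideal I -> fg_ideal I -> has_common_divisors I -> principal_ideal I.
Proof.
move=> idI [n [g IE]] cdI.
have Ig i : I (g i) by rewrite IE; apply: mem_ideal_span.
have [c Ic dvc] := common_divisor_family idI cdI Ig.
exists c; apply/seteqP; split=> x /=; last first.
  by case: idI => _ _ IM [a ->]; apply: IM.
rewrite IE => -[e ->].
have [u gE] := choice dvc; exists (\sum_(i < n) e i * u i).
by rewrite mulr_suml; apply: eq_bigr => i _; rewrite gE mulrA.
Qed.

Lemma bezout_pair : bezout_domain A ->
  forall a b, exists c a' b' u v,
    [/\ a = a' * c, b = b' * c & c = u * a + v * b].
Proof.
move=> bezA a b; pose g (i : 'I_2) := if i == ord0 then a else b.
have [c gE] : principal_ideal (ideal_span g).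
  by apply: bezA; [apply: is_ideal_span | exists 2, g].
have [a' aE] : exists a', a = a' * c.
  by have := mem_ideal_span g ord0; rewrite gE.
have [b' bE] : exists b', b = b' * c.
  by have := mem_ideal_span g ord_max; rewrite gE.
have [e cE] : ideal_span g c by rewrite gE; exists 1; rewrite mul1r.
exists c, a', b', (e ord0), (e ord_max); split=> //.
rewrite {1}cE !big_ord_recl big_ord0 addr0.
by congr (_ + e _ * _); apply: val_inj.
Qed.

Lemma bezout_prufer : bezout_domain A -> prufer_domain A.
Proof.
move=> bezA I idI fgI nzI; have [d IE] := bezA I idI fgI.
have d0 : d != 0.
  apply/eqP => d0; apply: nzI; rewrite IE d0; apply/seteqP; split=> x /=.
    by case=> c ->; rewrite mulr0.
  by move=> ->; exists 0; rewrite mulr0.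
have td0 : tofrac d != 0 by rewrite tofrac_eq0.
(* The inverse of the principal ideal [d A] is [d^-1 A]. *)
exists [set x | exists a, x = tofrac a / tofrac d].
  split.
  - by exists 0; rewrite tofrac0 mul0r.
  - by move=> _ _ [a ->] [b ->]; exists (a + b); rewrite tofracD mulrDl.
  - by move=> a _ [b ->]; exists (a * b); rewrite tofracM mulrA.
  - by exists d => // _ [a ->]; exists a; rewrite mulrC divfK.
apply/seteqP; split=> z /=.
  move=> [n [x [y [Ix Jy ->]]]].
  apply: (big_ind (fun u => range (@tofrac A) u)).
  - by exists 0; rewrite ?tofrac0.
  - by move=> _ _ [a _ <-] [b _ <-]; exists (a + b); rewrite ?tofracD.
  - move=> i _; have [r Ir <-] := Ix i; have [b ->] := Jy i.
    have [c ->] : exists c, r = c * d by rewrite IE in Ir.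
    exists (c * b) => //; rewrite !tofracM -mulrA [tofrac d * _]mulrCA.
    by rewrite mulfV // mulr1.
move=> [a _ <-]; exists 1, (fun=> tofrac d), (fun=> tofrac a / tofrac d).
split=> [_|_|]; first 2 last.
- by rewrite big_ord1 mulrC divfK.
- by exists d => //; rewrite IE; exists 1; rewrite mul1r.
- by exists a.
Qed.

(* With [B i j = q i * w j], where the [q i] lie in the inverse of the ideal
   and [1 = \sum_i q i * w i]. *)
Lemma invertible_span_coeffs n (w : 'I_n -> A) : invertible_ideal (ideal_span w) ->
  exists B : 'I_n -> 'I_n -> A,
    \sum_(i < n) B i i = 1 /\ forall i j k, B i j * w k = B i k * w j.
Proof.
move=> [J [J0 JD JM _] IJ].
have [m [x [y [Ix Jy oneE]]]] :
    frac_ideal_mul [set tofrac a | a in ideal_span w] J 1.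
  by rewrite IJ; exists 1; rewrite ?tofrac1.
have /choice[c xE] k : exists ck : 'I_n -> A,
    x k = tofrac (\sum_(i < n) ck i * w i).
  by have [_ [ck ->] <-] := Ix k; exists ck.
pose q i := \sum_(k < m) tofrac (c k i) * y k.
have Jq i : J (q i) by apply: big_ind => // k _; apply: JM.
have /choice[B BE] (ij : 'I_n * 'I_n) :
    exists b, tofrac b = q ij.1 * tofrac (w ij.2).
  have : range (@tofrac A) (q ij.1 * tofrac (w ij.2)).
    rewrite -IJ; exists 1, (fun=> tofrac (w ij.2)), (fun=> q ij.1).
    split=> // [_|]; last by rewrite big_ord1 mulrC.
    by exists (w ij.2) => //; apply: mem_ideal_span.
  by case=> b _ <-; exists b.
exists (fun i j => B (i, j)); split; last first.
  by move=> i j k; apply/eqP; rewrite -tofrac_eq !tofracM !BE /= mulrAC.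
apply/eqP; rewrite -tofrac_eq tofrac1 oneE rmorph_sum /=.
under eq_bigr => i _ do rewrite BE /= mulr_suml.
rewrite exchange_big; apply/eqP/eq_bigr => k _ /=.
rewrite xE rmorph_sum /= mulr_suml; apply: eq_bigr => i _.
by rewrite tofracM mulrAC.
Qed.

End IdealFacts.

(** * Ideals as torsion-free modules *)

Section IdealModule.
Variables (A : idomainType) (I : set A) (idI : is_ideal I).

(* The proof [idI] is an argument so that the module instances below can
   depend on it. *)
Definition ideal_pred of is_ideal I : {pred A^o} := fun x => `[< I x >].

Lemma ideal_pred_submod : submod_closed (ideal_pred idI).
Proof.
have [I0 ID IM] := idI; split; first exact/asboolP.
by move=> a x y /asboolP Ix /asboolP Iy; apply/asboolP/ID => //; apply: IM.
Qed.

HB.instance Definition _ :=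
  GRing.isSubmodClosed.Build A A^o (ideal_pred idI) ideal_pred_submod.

Record ideal_module := IdealModule {
  ideal_val :> A^o;
  ideal_valP : ideal_val \in ideal_pred idI }.

HB.instance Definition _ := [isSub for ideal_val].
HB.instance Definition _ := [Choice of ideal_module by <:].
HB.instance Definition _ := [SubChoice_isSubZmodule of ideal_module by <:].
HB.instance Definition _ := [SubZmodule_isSubLmodule of ideal_module by <:].

Lemma ideal_module_torsion_free : torsion_free ideal_module.
Proof.
move=> a x /(congr1 val)/eqP; rewrite linearZ linear0 /=.
by rewrite mulf_eq0 => /orP[]/eqP; [left | right; apply: val_inj].
Qed.

Lemma ps_ideal_common_divisors : ps_module ideal_module -> has_common_divisors I.
Proof.
move=> [_ psI] x y Ix Iy.
have [->|x0] := eqVneq x 0; first by exists y, 0, 1; rewrite mul0r mul1r.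
have [->|y0] := eqVneq y 0; first by exists x, 1, 0; rewrite mul0r mul1r.
pose x' := IdealModule (asboolT Ix); pose y' := IdealModule (asboolT Iy).
have [||||| c [d [e [z [yE xE /(congr1 val) xz /(congr1 val) yz]]]]] :=
  psI y x x' y' => //.
  exact/val_inj/mulrC.
by exists (val z), d, e; split=> //; apply/asboolP/ideal_valP.
Qed.

End IdealModule.

(** * Nonzero linear forms on finitely generated torsion-free modules *)

Section LinearForms.
Variables (A : idomainType) (M : lmodType A).
Hypothesis tfM : torsion_free M.

(* [w] lists the values on the [g i] of a nonzero linear form on their span. *)
Lemma nonzero_weights n (g : 'I_n -> M) : (exists i, g i != 0) ->
  exists2 w : 'I_n -> A, exists i, w i != 0 &
    forall c : 'I_n -> A, \sum_(i < n) c i *: g i = 0 -> \sum_(i < n) c i * w i = 0.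
Proof.
elim: n g => [|n IHn] g [i0 gi0]; first by case: i0 gi0.
pose g' i := g (lift ord0 i).
pose ext (a : A) (w : 'I_n -> A) i := oapp w a (unlift ord0 i).
have ext0 a w : ext a w ord0 = a by rewrite /ext unlift_none.
have extS a w i : ext a w (lift ord0 i) = w i by rewrite /ext liftK.
have [[i1 g'i1]|g'0] := pselect (exists i, g' i != 0); last first.
  have {}g'0 i : g' i = 0.
    by apply/eqP; apply: contrapT => /negP gi; apply: g'0; exists i.
  have g00 : g ord0 != 0.
    by case: (unliftP ord0 i0) gi0 => [j|] -> //; rewrite -/(g' j) g'0 eqxx.
  exists (ext 1 (fun=> 0)); first by exists ord0; rewrite ext0 oner_neq0.
  move=> c; rewrite !big_ord_recl ext0 mulr1.
  rewrite !big1 ?addr0 => [/tfM[//|/eqP]|i _|i _]; first by rewrite (negbTE g00).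
    by rewrite extS mulr0.
  by rewrite -/(g' i) g'0 scaler0.
have [w [i2 wi2] wP] := IHn g' (ex_intro _ i1 g'i1).
(* Either [g ord0] depends linearly on the other generators over the fraction field, or it is
   independent of them and may be given the value 0. *)
have [[d [e [d0 dE]]]|indep] := pselect (exists d (e : 'I_n -> A),
    d != 0 /\ d *: g ord0 = \sum_(i < n) e i *: g' i); last first.
  exists (ext 0 w); first by exists (lift ord0 i2); rewrite extS.
  move=> c; rewrite !big_ord_recl ext0 mulr0 add0r => sum0.
  have c0 : c ord0 = 0.
    apply: contrapT => /eqP c0; apply: indep.
    exists (c ord0), (fun i => - c (lift ord0 i)); split=> //.
    apply/eqP; rewrite -subr_eq0 -sumrN -[X in _ == X]sum0; apply/eqP.
    by congr (_ + _); apply: eq_bigr => i _; rewrite scaleNr opprK.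
  under eq_bigr do rewrite extS.
  by apply: wP; move: sum0; rewrite c0 scale0r add0r.
(* The form would take the value [(\sum_i e i * w i) / d] at [g ord0]; scaling everything by [d]
   keeps the values in [A]. *)
exists (ext (\sum_(i < n) e i * w i) (fun i => d * w i)).
  by exists (lift ord0 i2); rewrite extS mulf_neq0.
move=> c /(congr1 ( *:%R d)); rewrite !big_ord_recl scaler0 scalerDr.
rewrite scalerA mulrC -scalerA dE !scaler_sumr -big_split /= => sum0.
rewrite ext0 mulr_sumr -big_split /=.
rewrite -[RHS](wP (fun i => c ord0 * e i + d * c (lift ord0 i))).
  by apply: eq_bigr => i _; rewrite extS; ring.
by rewrite -[RHS]sum0; apply: eq_bigr => i _; rewrite scalerDl !scalerA.
Qed.

Lemma fg_nonzero_form n (g : 'I_n -> M) :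
    (forall x, exists c : 'I_n -> A, x = \sum_(i < n) c i *: g i) ->
    nonzero_module M ->
  exists2 f : M -> A, (forall a x y, f (a *: x + y) = a * f x + f y) &
    exists i, f (g i) != 0.
Proof.
move=> gP [x0 x0_neq0].
have nzg : exists i, g i != 0.
  apply: contrapT => g0; move/eqP: x0_neq0; apply; have [c ->] := gP x0.
  rewrite big1 // => i _; have [->|gi] := eqVneq (g i) 0; first exact: scaler0.
  by case: g0; exists i.
have [w nzw wP] := nonzero_weights nzg.
have [c cP] := choice gP.
(* Since [w] respects all relations among the [g i], the value at [x] does not depend on the chosen
   coefficients. *)
have fE x (d : 'I_n -> A) : x = \sum_(i < n) d i *: g i ->
    \sum_(i < n) c x i * w i = \sum_(i < n) d i * w i.
  move=> xE; apply/eqP; rewrite -subr_eq0 -sumrB.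
  under eq_bigr do rewrite -mulrBl.
  apply/eqP/wP; under eq_bigr do rewrite scalerBl.
  by rewrite sumrB -cP -xE subrr.
exists (fun x => \sum_(i < n) c x i * w i) => [a x y|].
  rewrite (fE _ (fun i => a * c x i + c y i)).
    by rewrite mulr_sumr -big_split; apply: eq_bigr => i _; rewrite /= mulrDl mulrA.
  rewrite {1}(cP x) {1}(cP y) scaler_sumr -big_split.
  by apply: eq_bigr => i _; rewrite /= scalerDl scalerA.
have [i wi] := nzw; exists i; rewrite (fE _ (fun j => (j == i)%:R)).
  rewrite (bigD1 i) //= eqxx mul1r big1 ?addr0 //.
  by move=> j /negbTE ->; rewrite mul0r.
rewrite (bigD1 i) //= eqxx scale1r big1 ?addr0 //.
by move=> j /negbTE ->; rewrite scale0r.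
Qed.

End LinearForms.

(** * The image of a linear form on a finitely generated PS module *)

Section PreSchreierBase.
Variables (A : idomainType) (M : lmodType A) (f : M -> A).
Hypothesis psM : ps_module M.
Variables (n : nat) (g : 'I_n -> M).
Hypothesis gP : forall x, exists c : 'I_n -> A, x = \sum_(i < n) c i *: g i.
Hypothesis f_lin : forall a x y, f (a *: x + y) = a * f x + f y.

Lemma form0 : f 0 = 0.
Proof.
by apply: (addrI (f 0)); have := f_lin 1 0 0; rewrite scale1r !addr0 mul1r.
Qed.

Lemma formZ a x : f (a *: x) = a * f x.
Proof. by rewrite -[a *: x]addr0 f_lin form0 addr0. Qed.

Lemma form_sum m (c : 'I_m -> A) (h : 'I_m -> M) :
  f (\sum_(i < m) c i *: h i) = \sum_(i < m) c i * f (h i).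
Proof.
elim: m c h => [|m IHm] c h; first by rewrite !big_ord0 form0.
by rewrite !big_ord_recl f_lin IHm.
Qed.

Lemma form_neq0 x : f x != 0 -> x != 0.
Proof. by apply: contra_neq => ->; rewrite form0. Qed.

Lemma form_image x : ideal_span (f \o g) (f x).
Proof. by have [c ->] := gP x; exists c; rewrite form_sum. Qed.

Lemma invertible_image_common_divisors :
    invertible_ideal (ideal_span (f \o g)) -> (exists i, f (g i) != 0) ->
  has_common_divisors (ideal_span (f \o g)).
Proof.
move=> /invertible_span_coeffs[B [trB symB]] [j0 fj0].
(* [b i] is the product of [r] with the [i]-th generator of the inverse ideal,
   so [\sum_i b i *: g i] is the image of [r] under a section of [f]. *)
have lift_span r : ideal_span (f \o g) r -> exists b : 'I_n -> A,
    forall i j, b i * f (g j) = r * B i j.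
  move=> [c ->]; exists (fun i => \sum_(j < n) c j * B i j) => i j.
  rewrite !mulr_suml; apply: eq_bigr => k _ /=.
  by rewrite -!mulrA (symB i k j) [f _ * _]mulrC.
have f_lift r b : (forall i j, b i * f (g j) = r * B i j) ->
    f (\sum_(i < n) b i *: g i) = r.
  move=> bE; rewrite form_sum; under eq_bigr do rewrite bE.
  by rewrite -mulr_sumr trB mulr1.
move=> r t Ir It.
have [->|r0] := eqVneq r 0; first by exists t, 0, 1; rewrite mul0r mul1r.
have [->|t0] := eqVneq t 0; first by exists r, 1, 0; rewrite mul0r mul1r.
have [b bE] := lift_span r Ir; have [b' b'E] := lift_span t It.
have [_ refM] := psM.
have [|||||c [d [e [z [tE rE rz tz]]]]] :=
    refM t r (\sum_(i < n) b i *: g i) (\sum_(i < n) b' i *: g i) => //.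
- by apply: form_neq0; rewrite (f_lift r).
- by apply: form_neq0; rewrite (f_lift t).
(* Coefficientwise, [t * b i = r * b' i]: multiplied by the nonzero [f (g j0)], both sides become
   [t * r * B i j0]. *)
- rewrite !scaler_sumr; apply: eq_bigr => i _; rewrite !scalerA.
  congr (_ *: _); apply: (mulIf fj0).
  by rewrite -!mulrA bE b'E; ring.
have frz : r = d * f z by rewrite -formZ -rz (f_lift r).
have ftz : t = e * f z by rewrite -formZ -tz (f_lift t).
by exists (f z), d, e; split=> //; apply: form_image.
Qed.

(* [f] divided by [c] is onto. *)
Lemma principal_image_pre_schreier :
    (exists i, f (g i) != 0) -> principal_ideal (ideal_span (f \o g)) ->
  ps_module A^o.
Proof.
move=> [i0 fi0] [c imE].
have im x : exists u, f x = u * c.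
  by have := form_image x; rewrite imE.
have c0 : c != 0.
  by have [u fE] := im (g i0); apply: contraNneq fi0 => c0; rewrite fE c0 mulr0.
have [m fm] : exists m, f m = c.
  have [e ->] : ideal_span (f \o g) c by rewrite imE; exists 1; rewrite mul1r.
  by exists (\sum_(i < n) e i *: g i); rewrite form_sum.
split=> [a x /eqP|a b x y a0 b0 x0 y0 axby].
  by rewrite mulf_eq0 => /orP[]/eqP; [left | right].
have nzm (u : A) : u != 0 -> u *: m != 0.
  by move=> u0; apply: form_neq0; rewrite formZ fm mulf_neq0.
have [_ refM] := psM.
(* The relation is moved to [M] along the multiples of [m]; applying [f] and cancelling [c] brings
   its refinement back to [A]. *)
have [|||||p [d [e [z [aE bE xE yE]]]]] := refM a b (x *: m) (y *: m) => //.
- exact: nzm.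
- exact: nzm.
- by rewrite !scalerA; congr (_ *: _).
have [u fz] := im z.
exists p, d, e, u; split=> //; apply: (mulIf c0).
  by rewrite -{1}fm -formZ xE formZ fz mulrA.
by rewrite -{1}fm -formZ yE formZ fz mulrA.
Qed.

End PreSchreierBase.

(** * Prufer pre-Schreier domains are Bezout *)

Section PruferSchreier.
Variable A : idomainType.
Hypotheses (prufA : prufer_domain A) (psA : ps_module A^o).

Lemma pre_schreier_refinement (a b x y : A) :
    a != 0 -> b != 0 -> x != 0 -> y != 0 -> a * x = b * y ->
  exists c d e z, [/\ a = c * e, b = c * d, x = d * z & y = e * z].
Proof. by move=> a0 b0 x0 y0 axby; have [_] := psA; apply. Qed.

(* The hypotheses say that [al / a] and [ga / a] lie in the inverse of [(a, b)]
   and that [a * (al / a) + b * (ga / a) = 1]. *)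
Lemma pre_schreier_gcd (a b al be ga de : A) : a != 0 -> b != 0 ->
    a * be = b * al -> a * de = b * ga -> al + de = 1 ->
  exists c u v s t, [/\ a = u * c, b = v * c & c = s * a + t * b].
Proof.
move=> a0 b0 e1 e2 e3.
have [al0|al0] := eqVneq al 0.
  have de1 : de = 1 by rewrite -e3 al0 add0r.
  by exists b, ga, 1, 0, 1; split; [rewrite mulrC -e2 de1 mulr1 | ring | ring].
have [de0|de0] := eqVneq de 0.
  have al1 : al = 1 by rewrite -e3 de0 addr0.
  by exists a, 1, be, 1, 0; split; [ring | rewrite mulrC e1 al1 mulr1 | ring].
have be0 : be != 0.
  by apply: contra_neq (mulf_neq0 b0 al0) => be0; rewrite -e1 be0 mulr0.
have ga0 : ga != 0.
  by apply: contra_neq (mulf_neq0 a0 de0) => ga0; rewrite e2 ga0 mulr0.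
(* The refinements give [al / a = f1 / c1] and [ga / a = f2 / c2], with [c1] and [c2] common
   divisors of [a] and [b]. *)
have [c1 [b1 [a1 [f1 [aE1 bE1 beE alE]]]]] :=
  pre_schreier_refinement a0 b0 be0 al0 e1.
have [c2 [b2 [a2 [f2 [aE2 bE2 deE gaE]]]]] :=
  pre_schreier_refinement a0 b0 de0 ga0 e2.
have mul_neq0 (u v w : A) : u != 0 -> u = v * w -> v != 0 /\ w != 0.
  by move=> u0 uE; apply/andP; rewrite -negb_or -mulf_eq0 -uE.
have [c10 a10] := mul_neq0 _ _ _ a0 aE1; have [_ b10] := mul_neq0 _ _ _ b0 bE1.
have [c20 a20] := mul_neq0 _ _ _ a0 aE2; have [_ b20] := mul_neq0 _ _ _ b0 bE2.
(* Next comes a common multiple of [c1] and [c2] still dividing [a] and [b]: refine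
   [c1 * a1 = c2 * a2], then the relation [v * b1 = w * b2] left by [c1 * b1 = c2 * b2]. *)
have [|p [w [v [t [c1E c2E a1E a2E]]]]] :=
  pre_schreier_refinement c10 c20 a10 a20; first by rewrite -aE1.
have [p0 v0] := mul_neq0 _ _ _ c10 c1E; have [_ w0] := mul_neq0 _ _ _ c20 c2E.
have [|q [k [h [l [vE wE b1E b2E]]]]] := pre_schreier_refinement v0 w0 b10 b20.
  by apply: (mulfI p0); rewrite !mulrA -c1E -c2E -bE1.
(* This element [c] equals both [c1 * k] and [c2 * h], so it clears both denominators: [c = c * al +
   c * de = (k * f1) * a + (h * f2) * b]. *)
exists (p * q * h * k), (q * t), l, (k * f1), (h * f2); split.
- by rewrite aE1 c1E a1E vE wE; ring.
- by rewrite bE1 c1E b1E vE; ring.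
rewrite -[LHS]mulr1 -e3 alE deE {1}aE1 {1}bE1 c1E a1E b1E b2E vE wE.
by ring.
Qed.

Lemma prufer_pre_schreier_bezout : bezout_domain A.
Proof.
move=> I idI fgI; apply: common_divisors_principal => // a b Ia Ib.
have [->|a0] := eqVneq a 0; first by exists b, 0, 1; rewrite mul0r mul1r.
have [->|b0] := eqVneq b 0; first by exists a, 1, 0; rewrite mul0r mul1r.
pose g (i : 'I_2) := if i == ord0 then a else b.
have /invertible_span_coeffs[B [trB symB]] : invertible_ideal (ideal_span g).
  apply: prufA; [exact: is_ideal_span | by exists 2, g |].
  by move=> g0; have := mem_ideal_span g ord0; rewrite g0 => /eqP; apply/negP.
(* The first index of [B] selects the element of the inverse ideal, the second selects [a] or
   [b]. *)
have [||||| c [u [v [s [t [aE bE cE]]]]]] := @pre_schreier_gcd a b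
    (B ord0 ord0) (B ord0 ord_max) (B ord_max ord0) (B ord_max ord_max) => //.
- by have := symB ord0 ord_max ord0; rewrite ![_ * g _]mulrC.
- by have := symB ord_max ord_max ord0; rewrite ![_ * g _]mulrC.
- rewrite -trB !big_ord_recl big_ord0 addr0.
  by congr (_ + B _ _); apply: val_inj.
exists c, u, v; split=> //; rewrite cE.
by have [_ ID IM] := idI; apply: ID; apply: IM.
Qed.

End PruferSchreier.

(** * The implications of the equivalence *)

Lemma prufer_ps_bezout (A : idomainType) (M : lmodType A) : prufer_domain A ->
  nonzero_module M -> fg_module M -> ps_module M -> bezout_domain A.
Proof.
move=> prufA nzM [n [g gP]] psM; apply: prufer_pre_schreier_bezout => //.
have [f f_lin nzf] := fg_nonzero_form psM.1 gP nzM.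
have inv_im : invertible_ideal (ideal_span (f \o g)).
  apply: prufA; [exact: is_ideal_span | by exists n, (f \o g) |].
  have [i fi] := nzf => im0.
  by have := mem_ideal_span (f \o g) i; rewrite im0 => /eqP; apply/negP.
apply: (principal_image_pre_schreier psM gP f_lin nzf).
apply: common_divisors_principal; [exact: is_ideal_span | by exists n, (f \o g) |].
exact: (invertible_image_common_divisors psM gP f_lin inv_im nzf).
Qed.

Lemma bezout_torsion_free_ps (A : idomainType) (M : lmodType A) :
  bezout_domain A -> torsion_free M -> ps_module M.
Proof.
move=> bezA tfM; split=> // a b x y a0 b0 _ _ axby.
have [c [a' [b' [u [v [aE bE cE]]]]]] := bezout_pair bezA a b.
have c0 : c != 0 by apply: contraNneq a0 => c0; rewrite aE c0 mulr0.
have uv1 : u * a' + v * b' = 1.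
  by apply: (mulIf c0); rewrite mul1r [RHS]cE aE bE; ring.
have a'xb'y : a' *: x = b' *: y.
  have : c *: (a' *: x - b' *: y) = 0.
    by rewrite scalerBr !scalerA ![c * _]mulrC -aE -bE axby subrr.
  by case/tfM => [/eqP|/eqP]; [rewrite (negbTE c0) | rewrite subr_eq0 => /eqP].
(* As [b' *: y = a' *: x], multiplying this element by [b'] gives [(u * a' + v * b') *: x = x];
   multiplying it by [a'] gives [y] likewise. *)
exists c, b', a', (u *: y + v *: x); split; rewrite ?[c * _]mulrC //.
- rewrite scalerDr !scalerA [b' * u]mulrC -[_ *: y]scalerA -a'xb'y scalerA -scalerDl.
  by rewrite [b' * v]mulrC uv1 scale1r.
- rewrite scalerDr !scalerA [a' * v]mulrC -[_ *: x]scalerA a'xb'y scalerA -scalerDl.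
  by rewrite [a' * u]mulrC uv1 scale1r.
Qed.

Theorem proposition2p14 (A : idomainType) :
  [<-> bezout_domain A;
       prufer_domain A /\
         (exists M : lmodType A, [/\ nonzero_module M, fg_module M & ps_module M]);
       forall M : lmodType A, torsion_free M -> ps_module M].
Proof.
tfae.
- move=> bezA; split; first exact: bezout_prufer.
  exists A^o; split; first by exists 1; rewrite oner_neq0.
    by exists 1%N, (fun=> 1) => x; exists (fun=> x); rewrite big_ord1 [_ *: _]mulr1.
  apply: bezout_torsion_free_ps => // a x /eqP.
  by rewrite mulf_eq0 => /orP[]/eqP; [left | right].
- move=> [prufA [M0 [nzM fgM psM]]] M tfM; apply: bezout_torsion_free_ps => //.
  exact: (prufer_ps_bezout prufA nzM fgM psM).
- move=> psA I idI fgI; apply: common_divisors_principal => //.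
  apply: (@ps_ideal_common_divisors _ _ idI).
  exact/psA/ideal_module_torsion_free.
Qed.
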